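(* The totally nonnegative part $Y_{\ge0}$ of the Peterson variety $Y\subset SL_{n+1}(\mathbb C)/B^-$ is contractible.
   Context: $G=SL_{n+1}(\mathbb C)$, $B^-$ the lower-triangular subgroup, $\mathfrak b^-=Lie(B^-)$, $I=\{1,\dots,n\}$. $e_i$ is the matrix with $1$ in position $(i,i+1)$ and $0$ elsewhere, $f_i$ its transpose, $x_i(t)=\exp(te_i)$, $f=f_1+\dots+f_n$. The Peterson variety is $Y=\{gB^-\in G/B^-: g^{-1}fg\in\mathfrak b^-\oplus\sum_{i\in I}\mathbb Ce_i\}$. Let $w_0$ be the longest element of the Weyl group $W\cong S_{n+1}$ with simple reflections $s_1,\dots,s_n$, and $U^+_{>0}=\{x_{i_1}(t_1)\cdots x_{i_N}(t_N): t_j\in\mathbb R_{>0}\}$ for a (any) reduced expression $w_0=s_{i_1}\cdots s_{i_N}$. $(G/B^-)_{>0}=\{uB^-:u\in U^+_{>0}\}$ and $(G/B^-)_{\ge0}$ is its closure in the real flag variety $(G/B^-)(\mathbb R)$ with its topology as a real manifold. $Y_{\ge0}=Y(\mathbb R)\cap(G/B^-)_{\ge0}$, with the subspace topology. *)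

(* Defs.v *)
From HB Require Import structures.
From mathcomp Require Import all_boot all_order all_algebra all_fingroup.
From mathcomp Require Import generic_quotient complex.
From mathcomp Require Import all_classical all_reals all_analysis.
Import numFieldNormedType.Exports.

Set Implicit Arguments.
Unset Strict Implicit.
Unset Printing Implicit Defensive.

Import Order.TTheory GRing.Theory Num.Theory.
Local Open Scope classical_set_scope.
Local Open Scope ring_scope.
Local Open Scope quotient_scope.

Section LieAlgebra.
Context {K : fieldType} {n : nat}.

(* The index i : 'I_n stands for i + 1 in I = {1, ..., n}; counting from 0,
   the entry 1 of chev_e i is in row i and column i + 1. *)
Definition chev_e (i : 'I_n) : 'M[K]_n.+1 :=
  delta_mx (widen_ord (leqnSn n) i) (lift ord0 i).

Definition chev_f (i : 'I_n) : 'M[K]_n.+1 := (chev_e i)^T.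

Definition prin_f : 'M[K]_n.+1 := \sum_(i < n) chev_f i.

(* is_trig_mx means lower triangular: A i j = 0 whenever i < j. *)
Definition lie_Bminus : set 'M[K]_n.+1 :=
  [set A | is_trig_mx A /\ \tr A = 0].

(* Lie(B^-) + sum_i K e_i *)
Definition lie_Bminus_plus_simple : set 'M[K]_n.+1 :=
  [set A | exists (b : 'M[K]_n.+1) (c : 'I_n -> K),
    lie_Bminus b /\ A = b + \sum_(i < n) c i *: chev_e i].

End LieAlgebra.

Lemma trig_mulmx (K : fieldType) n (A B : 'M[K]_n) :
  is_trig_mx A -> is_trig_mx B -> is_trig_mx (A *m B).
Proof.
move=> /is_trig_mxP tA /is_trig_mxP tB; apply/is_trig_mxP => i j ij.
rewrite mxE big1 // => k _; have [ik|ki] := ltnP i k.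
  by rewrite tA // mul0r.
by rewrite tB ?mulr0 // (leq_ltn_trans ki).
Qed.

Lemma trig_invmx (K : fieldType) n (A : 'M[K]_n) :
  A \in unitmx -> is_trig_mx A -> is_trig_mx (invmx A).
Proof.
move=> uA tA; have /is_trig_mxP tA' := tA.
have Aii i : A i i != 0.
  move: uA; rewrite unitmxE det_trig // unitfE => /prodf_neq0 /(_ i); exact.
suff H m (i j : 'I_n) : (i < m)%N -> (i < j)%N -> invmx A i j = 0.
  by apply/is_trig_mxP => i j; exact: (H i.+1).
elim: m i j => // m IH i j im ij.
have := congr1 (fun M : 'M[K]_n => M i j) (mulmxV uA).
have -> : 1%:M i j = 0 :> K.
  by rewrite mxE; case: eqP ij => // ->; rewrite ltnn.
rewrite mxE (bigD1 i) //= big1 => [|k ki].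
  by rewrite addr0 => /eqP; rewrite mulf_eq0 (negPf (Aii i)) => /eqP.
have [ik|] := ltnP i k; first by rewrite tA' // mul0r.
rewrite leq_eqVlt => /orP[/eqP/val_inj kE|lki]; first by rewrite kE eqxx in ki.
by rewrite IH ?mulr0 //; [exact: leq_trans lki im|exact: ltn_trans ij].
Qed.

(* SL K n is SL_(n+1)(K). For K : realType it carries, as a set_type, the
   topology induced from 'M[K]_n.+1. *)
Definition SL (K : fieldType) (n : nat) :=
  set_type [set g : 'M[K]_n.+1 | \det g = 1].

Section FlagVariety.
Context {K : fieldType} {n : nat}.
Implicit Types g h k : SL K n.

Lemma SL_unit g : \val g \in unitmx.
Proof. by rewrite unitmxE (set_mem (valP g)) unitr1. Qed.

(* g B^- = h B^- *)
Definition same_coset g h : bool := is_trig_mx (invmx (\val g) *m \val h).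

Lemma same_coset_equiv : equiv_class_of same_coset.
Proof.
have sym x y : same_coset x y -> same_coset y x.
  rewrite /same_coset => /trig_invmx.
  rewrite unitmx_mul unitmx_inv !SL_unit => /(_ isT).
  have -> // : invmx (invmx (\val x) *m \val y) = invmx (\val y) *m \val x.
  have uy := SL_unit y; have ux : invmx (\val x) \in unitmx.
    by rewrite unitmx_inv SL_unit.
  by have := invrM ux uy; rewrite -[in RHS]/(invmx _) [(invmx _)^-1]invmxK.
split=> [g|g h|h g k]; last rewrite /same_coset => gh hk.
- by rewrite /same_coset mulVmx ?SL_unit // scalar_mx_is_trig.
- by apply/idP/idP; exact: sym.
- have -> : invmx (\val g) *m \val k =
      (invmx (\val g) *m \val h) *m (invmx (\val h) *m \val k).
    by rewrite mulmxA mulmxK ?SL_unit.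
  exact: trig_mulmx.
Qed.

Canonical same_coset_rel := EquivRelPack same_coset_equiv.

End FlagVariety.

(* G/B^- over K, as a set *)
Definition flag (K : fieldType) (n : nat) := {eq_quot @same_coset K n}.

Definition peterson (K : fieldType) (n : nat) : set (flag K n) :=
  [set x | exists g : SL K n, x = \pi g /\
     lie_Bminus_plus_simple (invmx (\val g) *m prin_f *m \val g)].

Section RealPoints.
Context {R : realType} {n : nat}.

Lemma SL_complexify_subproof (g : SL R n) :
  map_mx (real_complex R) (\val g) \in [set h : 'M[R[i]]_n.+1 | \det h = 1].
Proof. by rewrite inE /= det_map_mx (set_mem (valP g)) rmorph1. Qed.

Definition SL_complexify (g : SL R n) : SL R[i] n :=
  Sub (map_mx (real_complex R) (\val g)) (SL_complexify_subproof g).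

(* (G/B^-)(R) with the quotient topology of SL_(n+1)(R) *)
Definition real_flag := quotient_topology (flag R n).

(* The inclusion of (G/B^-)(R) into G/B^-; see flag_complexify_pi. *)
Definition flag_complexify (x : real_flag) : flag R[i] n :=
  \pi_(flag R[i] n) (SL_complexify (repr x)).

Lemma flag_complexify_pi (g : SL R n) :
  flag_complexify (\pi_(real_flag) g) = \pi_(flag R[i] n) (SL_complexify g).
Proof.
have /eqmodP : \pi_(flag R n) (repr (\pi_(real_flag) g)) = \pi_(flag R n) g.
  exact: (reprK (\pi_(real_flag) g)).
rewrite /= /same_coset => tg; apply/eqmodP; rewrite /= /same_coset /=.
rewrite -map_invmx -map_mxM; apply/is_trig_mxP => i j ij.
by rewrite mxE (is_trig_mxP tg) ?rmorph0.
Qed.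

(* Y(R) *)
Definition real_peterson : set real_flag :=
  flag_complexify @^-1` @peterson R[i] n.

End RealPoints.
Arguments real_flag : clear implicits.


(* The Weyl group of SL_(n+1) is identified with 'S_n.+1, s_i being the
   transposition of i and i + 1 (counting from 0). *)
Section WeylGroup.
Context {n : nat}.

Definition simple_refl (i : 'I_n) : 'S_n.+1 :=
  tperm (widen_ord (leqnSn n) i) (lift ord0 i).

Definition word_prod (w : seq 'I_n) : 'S_n.+1 :=
  (\prod_(i <- w) simple_refl i)%g.

Definition reduced_expression (v : 'S_n.+1) (w : seq 'I_n) : Prop :=
  word_prod w = v /\
  forall w', word_prod w' = v -> (size w <= size w')%N.

Definition longest_element (w0 : 'S_n.+1) : Prop :=
  exists2 w, reduced_expression w0 w &
    forall v w', reduced_expression v w' -> (size w' <= size w)%N.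

End WeylGroup.

Section TotalPositivity.
Context {R : realType} {n : nat}.

Definition expmx (A : 'M[R]_n.+1) : 'M[R]_n.+1 :=
  limn (series (fun k => (k`!%:R)^-1 *: A ^+ k)).

Definition chev_x (i : 'I_n) (t : R) : 'M[R]_n.+1 := expmx (t *: chev_e i).

(* U^+_{>0}, as the set of products x_{i_1}(t_1) ... x_{i_N}(t_N) for a word
   w = i_1 ... i_N in I *)
Definition Uplus_pos (w : seq 'I_n) : set 'M[R]_n.+1 :=
  [set u | exists t : seq R, [/\ size t = size w, all (> 0) t &
     u = \prod_(p <- zip w t) chev_x p.1 p.2]].

Definition flag_pos (w : seq 'I_n) : set (real_flag R n) :=
  [set x | exists2 u : SL R n, Uplus_pos w (\val u) & x = \pi u].

Definition flag_nneg (w : seq 'I_n) : set (real_flag R n) :=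
  closure (flag_pos w).

Definition peterson_nneg (w : seq 'I_n) : set (real_flag R n) :=
  real_peterson `&` flag_nneg w.

End TotalPositivity.

(* The identity of T is homotopic to a constant map. *)
Definition contractible (R : realType) (T : topologicalType) : Prop :=
  exists (c : T) (H : T * R -> T),
    [/\ {within [set: T] `*` `[0, 1], continuous H},
        forall x, H (x, 0) = x & forall x, H (x, 1) = c].

(* Main.v *)
Require Import Defs.
From mathcomp Require Import all_boot all_order all_algebra all_fingroup.
From mathcomp Require Import generic_quotient complex zify ring lra.
From mathcomp Require Import all_classical all_reals all_analysis.
Import numFieldNormedType.Exports.

(** The contraction comes from a one-parameter family in the centralizer
of the principal nilpotent f.  With y_i(a) = 1 + a f_i, put
P(a) = y_n(a) ... y_1(a).  Telescoping gives P(a) = (1 - a f)^-1, so P(a) and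
h(a) = P(a)^n commute with f, and left multiplication by h(a) preserves the
Peterson variety: conjugating f by h(a) g is conjugating it by g
([flag_act_real_peterson], [contraction_comm]).

For a >= 0 it also preserves the totally positive part.  Pushing y_i(a) to the
right through a product x_w(t) of one-parameter subgroups changes the
parameters t_j into other positive numbers, keeps the word w, and leaves a
factor in B^- ([borel_factor_upper], [lower_Uplus_pos]).  By continuity h(a)
preserves the closure.

As a grows, h(a) moves every totally nonnegative flag to the base point
B^-, uniformly.  For x_w(t) write h(a) x_w(t) = v b with v = x_w(t') and
b in B^-; then 0 <= v_kl <= C a^-(l-k) with C independent of a and t
([contraction_bound]).  The reason is the effect of a single y_i(a): it divides column i+1 by
1 + a v_(i,i+1), and total nonnegativity gives
v_(k,i+1) <= v_(k,i) v_(i,i+1), so that a bound on column i becomes a bound on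
column i+1 ([col_bounded_lower]).  One factor P(a) carries the trivial bound on
the first column to the last column that was not yet bounded, and preserves
the bounds on the columns after it; n factors bound them all.  The uniform
estimate extends from the totally positive part to its closure because the
projection of SL to the flag variety is open ([flow_contraction]).

Consequently (x, t) |-> h(t / (1 - t)) x for t < 1, and (x, 1) |-> B^-, is
continuous on Y_{>=0} x [0, 1], starts at the identity because h(0) = 1, and
ends at a constant map. *)

Set Implicit Arguments.
Unset Strict Implicit.
Unset Printing Implicit Defensive.

Import Order.TTheory GRing.Theory Num.Theory.
Local Open Scope classical_set_scope.
Local Open Scope ring_scope.
Local Open Scope quotient_scope.

(** * Elementary matrices and the exchange relation *)

(* Splits on the equality of natural numbers wherever a boolean test on them
   occurs, unless arithmetic already decides it. *)
Ltac nateq := repeat match goal with |- context [@eq_op _ ?x ?y] =>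
  (have -> : (x == y) = true by lia) || (have -> : (x == y) = false by lia) ||
  (case: (eqVneq x y) => ?; try by exfalso; lia) end.

(* Evaluates sums and products once the boolean tests in them are decided. *)
Definition simp_bool {K : fieldType} :=
  (@mulr1n K, @mulr0n K, @mul0r K, @mul1r K, @mulr0 K, @mulr1 K,
   @add0r K, @addr0 K).

Section Elementary.
Context {K : fieldType} {n : nat}.
Implicit Types (M : 'M[K]_n.+1) (i j : 'I_n) (k l : 'I_n.+1).

Definition lo i : 'I_n.+1 := widen_ord (leqnSn n) i.
Definition hi i : 'I_n.+1 := lift ord0 i.
Definition upper i (t : K) : 'M[K]_n.+1 := 1 + t *: chev_e i.
Definition lower i (a : K) : 'M[K]_n.+1 := 1 + a *: chev_f i.

Lemma mul_delta_r M (p q k l : 'I_n.+1) :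
  (M *m delta_mx p q) k l = (l == q)%:R * M k p.
Proof.
rewrite mxE (bigD1 p) //= big1 => [|m /negPf mp]; last by rewrite mxE mp mulr0.
by rewrite mxE eqxx addr0 mulrC.
Qed.

Lemma mul_delta_l M (p q k l : 'I_n.+1) :
  (delta_mx p q *m M) k l = (k == p)%:R * M q l.
Proof.
rewrite mxE (bigD1 q) //= big1 => [|m /negPf mp]; last first.
  by rewrite mxE mp andbF mul0r.
by rewrite mxE eqxx andbT addr0.
Qed.

(* From here on, products with elementary matrices are handled entrywise:
   right multiplication is a column operation, left multiplication a row
   operation. *)
Lemma mul_upper M i t k l :
  (M *m upper i t) k l = M k l + (l == hi i)%:R * (t * M k (lo i)).
Proof.
by rewrite mulmxDr mulmx1 -scalemxAr mxE [X in _ + X]mxE mul_delta_r mulrCA.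
Qed.

Lemma upper_mul M i t k l :
  (upper i t *m M) k l = M k l + (k == lo i)%:R * (t * M (hi i) l).
Proof.
by rewrite mulmxDl mul1mx -scalemxAl mxE [X in _ + X]mxE mul_delta_l mulrCA.
Qed.

Lemma chev_fE i : chev_f i = delta_mx (hi i) (lo i) :> 'M[K]_n.+1.
Proof. by rewrite /chev_f trmx_delta. Qed.

Lemma lower_mul M i a k l :
  (lower i a *m M) k l = M k l + (k == hi i)%:R * (a * M (lo i) l).
Proof.
rewrite mulmxDl mul1mx -scalemxAl chev_fE mxE [X in _ + X]mxE mul_delta_l.
by rewrite mulrCA.
Qed.

(** The identity outside the rows and columns i and i+1, where it is the
2 x 2 block with rows (r^-1, 0) and (q, r): a general element of B^- of the
SL_2 attached to i. *)
Definition borel_factor i (r q : K) : 'M[K]_n.+1 :=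
  1 + (r^-1 - 1) *: delta_mx (lo i) (lo i) + (r - 1) *: delta_mx (hi i) (hi i)
    + q *: chev_f i.

Lemma mul_borel_factor M i r q k l :
  (M *m borel_factor i r q) k l = M k l
    + (l == lo i)%:R * ((r^-1 - 1) * M k (lo i) + q * M k (hi i))
    + (l == hi i)%:R * ((r - 1) * M k (hi i)).
Proof.
rewrite !mulmxDr mulmx1 -!scalemxAr chev_fE.
have D (A B : 'M[K]_n.+1) : (A + B) k l = A k l + B k l by rewrite mxE.
have Z c (A : 'M[K]_n.+1) : (c *: A) k l = c * A k l by rewrite mxE.
rewrite !D !Z !mul_delta_r; ring.
Qed.

(** For j = i this is the factorization of a 2 x 2 matrix of determinant 1
into upper unipotent times lower triangular.  For j <> i the lower and
upper unipotent factors commute, and only the torus part acts: it rescales s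
by r when i and j are adjacent. *)
Lemma borel_factor_upper i j (r q s : K) : r != 0 -> r + q * s != 0 ->
  borel_factor i r q *m upper j s =
  if j == i then upper i (s / r / (r + q * s)) *m borel_factor i (r + q * s) q
  else upper j (s * (if (j == i.+1 :> nat) || (i == j.+1 :> nat) then r else 1))
    *m borel_factor i r q.
Proof.
move=> r0 rqs.
have E r' q' k l : borel_factor i r' q' k l = (k == l)%:R
    + (l == lo i)%:R * ((r'^-1 - 1) * (k == lo i)%:R + q' * (k == hi i)%:R)
    + (l == hi i)%:R * ((r' - 1) * (k == hi i)%:R).
  by rewrite -[borel_factor _ _ _]mul1mx mul_borel_factor !mxE.
apply/matrixP => k l; rewrite mul_upper.
case: (eqVneq j i) => [->|ji]; rewrite upper_mul !E.
  rewrite eqxx -!val_eqE /= /bump /= !add1n.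
  move: (val i) (val k) (val l) => {E}i {}k {}l.
  nateq; rewrite /nat_of_bool ?simp_bool //;
  by field; rewrite ?r0 ?rqs.
move: ji; rewrite -!val_eqE /= /bump /= !add1n !eqSS.
move: (val i) (val j) (val k) (val l) => {E}i {}j {}k {}l ji.
nateq; rewrite /nat_of_bool /= ?simp_bool //.
all: by field.
Qed.
End Elementary.

(** * Totally positive unipotent matrices *)

Section Positive.
Context {R : realType} {n : nat}.
Implicit Types (u : 'M[R]_n.+1) (i j : 'I_n) (k l : 'I_n.+1) (w : seq 'I_n).

Lemma expmx_sq0 (A : 'M[R]_n.+1) : A *m A = 0 -> expmx A = 1 + A.
Proof.
move=> AA; apply: cvg_lim => //.
rewrite -(cvg_shiftn 2) /=.
have -> : (fun N => series (fun N => (N`!%:R)^-1 *: A ^+ N) (N + 2)%N)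
    = (fun _ => 1 + A).
  apply/funext => K; rewrite /series /= addn2 big_nat_recl // big_nat_recl //=.
  rewrite big1 ?addr0 => [|m _]; last first.
    by rewrite exprSr exprSr -mulrA [A * A]AA mulr0 scaler0.
  by rewrite fact0 invr1 !scale1r expr0 expr1.
exact: cvg_cst.
Qed.

Lemma chev_xE i (t : R) : chev_x i t = upper i t.
Proof.
rewrite /chev_x expmx_sq0 // -scalemxAl -scalemxAr.
apply/matrixP => k l; rewrite mxE (mxE scalemx_key) mul_delta_r mxE.
by rewrite -[widen_ord _ i == _]val_eqE /= ltn_eqF // andbF !mulr0 mxE.
Qed.

Lemma Uplus_pos_nil u : Uplus_pos [::] u -> u = 1.
Proof. by move=> [[|t0 t] []] //= _ _ ->; rewrite big_nil. Qed.

Lemma Uplus_pos1 : Uplus_pos [::] (1 : 'M[R]_n.+1).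
Proof. by exists [::]; rewrite /= big_nil. Qed.

(** The form of the definition suited to induction on the word from the right,
where a factor of B^- arrives when pushed through from the left. *)
Lemma Uplus_pos_rcons w j u : Uplus_pos (rcons w j) u <->
  exists v s, [/\ Uplus_pos w v, 0 < s & u = v *m upper j s].
Proof.
split=> [[t []]|[v [s [[t [st tp ->]] s0 ->]]]].
  case/lastP: t => [|t s]; first by rewrite size_rcons.
  rewrite !size_rcons all_rcons => -[st] /andP[s0 tp] ->.
  exists (\prod_(p <- zip w t) chev_x p.1 p.2), s; split=> //; first by exists t.
  by rewrite zip_rcons ?st // -cats1 big_cat /= big_seq1 /= chev_xE.
exists (rcons t s); split; first by rewrite !size_rcons st.
  by rewrite all_rcons tp s0.
by rewrite zip_rcons ?st // -cats1 big_cat /= big_seq1 /= chev_xE.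
Qed.

Lemma Uplus_pos_nonempty w : exists u : 'M[R]_n.+1, Uplus_pos w u.
Proof.
elim/last_ind: w => [|w j [u wu]]; first by exists 1; exact: Uplus_pos1.
by exists (u *m upper j 1); apply/Uplus_pos_rcons; exists u, 1.
Qed.

(** The last inequality is the nonnegativity of the 2 x 2 minor with rows k, i
and columns i, i+1, since the entry (i, i) is 1.  Each right factor x_j(s) adds
s times column j to column j+1: for j = i both sides grow equally, for
j + 1 = i only the right side grows, and otherwise neither changes. *)
Lemma Uplus_pos_entries w u : Uplus_pos w u ->
  [/\ forall k l, (l < k)%N -> u k l = 0, forall k, u k k = 1,
      forall k l, 0 <= u k l &
      forall k i, (k <= i)%N -> u k (hi i) <= u k (lo i) * u (lo i) (hi i)].
Proof.
elim/last_ind: w u =>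
  [u /Uplus_pos_nil ->|w j IH u /Uplus_pos_rcons[v [s [/IH]]]].
  split=> [k l lk|k|k l|k i ki].
  - by rewrite !mxE -val_eqE /= gtn_eqF.
  - by rewrite !mxE eqxx.
  - by rewrite !mxE ler0n.
  - by rewrite !mxE -!val_eqE /= ltn_eqF ?ltnS // mulr_ge0 ?ler0n.
move=> [v0 v1 vp vm] s0 ->; split=> [k l lk|k|k l|k i ki]; rewrite !mul_upper.
- rewrite v0 // add0r; case: eqP => [E|]; rewrite ?mul0r //.
  by rewrite v0 ?mulr0 // (ltn_trans _ lk) // E.
- rewrite v1; case: eqP => [->|]; rewrite ?mul0r ?addr0 //.
  by rewrite v0 ?mulr0 ?addr0 //= ltnS.
- by rewrite addr_ge0 // mulr_ge0 // mulr_ge0 // ltW.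
have := vm k i ki; have := vp k (lo i); have := vp (lo i) (hi i).
have := vp k (lo j); have -> : (hi i == hi j) = (i == j) by rewrite -!val_eqE.
case: (eqVneq i j) => [<-|ij].
  have -> : (lo i == hi i) = false by rewrite -val_eqE /= ltn_eqF.
  rewrite v1 /= !mul1r !mul0r !addr0 mulr1 mulrDr => *; rewrite -mulrC; lra.
move=> A B C D; rewrite /= !mul0r !addr0 mulrDl; apply: le_trans D _.
by rewrite lerDl; apply: mulr_ge0 => //; rewrite !mulr_ge0 // ltW.
Qed.

Lemma borel_factor_trig i (r q : R) : is_trig_mx (borel_factor i r q).
Proof.
apply/is_trig_mxP => k l kl; rewrite -[borel_factor _ _ _]mul1mx mul_borel_factor.
rewrite !mxE -!val_eqE /= (ltn_eqF kl) /= add0r /bump leq0n add1n.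
by nateq; rewrite /nat_of_bool ?simp_bool.
Qed.

(** Left multiplication by y_i(a) stays in the set attached to the same word,
up to a factor in B^-.  That r >= 1 and q >= 0 persist along the word keeps
all new parameters positive. *)
Lemma lower_Uplus_pos w u i (a : R) : 0 <= a -> Uplus_pos w u ->
  exists v r q, [/\ Uplus_pos w v, 1 <= r, 0 <= q &
                    lower i a *m u = v *m borel_factor i r q].
Proof.
move=> a0; elim/last_ind: w u => [u /Uplus_pos_nil ->|w j IH u0].
  exists 1, 1, a; split=> //; first exact: Uplus_pos1.
  by rewrite mul1mx mulmx1 /borel_factor invr1 subrr !scale0r !addr0.
move=> /Uplus_pos_rcons[u [s [/IH[v [r [q [wv r1 q0 E]]]] s0 ->]]].
have r0 : 0 < r by exact: lt_le_trans r1.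
have rqs : 1 <= r + q * s by rewrite (le_trans r1) // lerDl mulr_ge0 // ltW.
have rqs0 : r + q * s != 0 by exact/lt0r_neq0/(lt_le_trans ltr01 rqs).
have := borel_factor_upper i j (lt0r_neq0 r0) rqs0.
rewrite mulmxA E -mulmxA => ->; rewrite fun_if; case: eqVneq => [->|_].
  exists (v *m upper i (s / r / (r + q * s))), (r + q * s), q; split=> //.
    apply/Uplus_pos_rcons; exists v, (s / r / (r + q * s)); split=> //.
    by rewrite !divr_gt0 // (lt_le_trans ltr01).
  by rewrite mulmxA.
set c := if _ then _ else _.
exists (v *m upper j (s * c)), r, q; split=> //; last by rewrite mulmxA.
apply/Uplus_pos_rcons; exists v, (s * c); split=> //.
by rewrite mulr_gt0 // /c; case: ifP.
Qed.

(** The weight a^(l-k) is the one by which the conjugation relating different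
values of a scales the entry (k, l); with it the bounds do not depend on a. *)
Definition col_bounded (a C : R) u l := forall k, u k l * a ^+ (l - k) <= C.

Lemma col_bounded_le (a C D : R) u l :
  C <= D -> col_bounded a C u l -> col_bounded a D u l.
Proof. by move=> CD b k; exact: le_trans CD. Qed.

(** The three cases are the three kinds of columns for y_i(a).  A column other
than i and i+1 only undergoes a row operation.  Column i+1 is divided by
r = 1 + a u_(i,i+1) above its diagonal entry, so it is bounded as soon as
column i is, by the 2 x 2 minor inequality, and it stays bounded if it was.
Column i is multiplied by at most r, which is bounded if column i+1 is. *)
Lemma col_bounded_lower w u v i (a r q C : R) l :
  0 < a -> 1 <= C -> 1 <= r -> 0 <= q -> Uplus_pos w u -> Uplus_pos w v ->
  lower i a *m u = v *m borel_factor i r q ->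
  [\/ [/\ l != lo i, l != hi i & col_bounded a C u l],
      l = hi i /\ (col_bounded a C u (lo i) \/ col_bounded a C u (hi i)) |
      [/\ l = lo i, col_bounded a C u (lo i) & col_bounded a C u (hi i)]] ->
  col_bounded a ((1 + C) * C) v l.
Proof.
move=> a0 C1 r1 q0 /Uplus_pos_entries[u0 u1 up um].
move=> /Uplus_pos_entries[v0 v1 vp _] E.
have C0 : 0 < C by exact: lt_le_trans C1.
have CC : C <= (1 + C) * C by rewrite mulrDl mul1r lerDl mulr_ge0 // ltW.
have lh : (lo i == hi i) = false by rewrite -val_eqE /= ltn_eqF.
have hl : (hi i == lo i) = false by rewrite eq_sym.
have {}E k l' : u k l' + (k == hi i)%:R * (a * u (lo i) l') =
    v k l' + (l' == lo i)%:R * ((r^-1 - 1) * v k (lo i) + q * v k (hi i))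
           + (l' == hi i)%:R * ((r - 1) * v k (hi i)).
  by rewrite -lower_mul E mul_borel_factor.
set m := u (lo i) (hi i).
(* Entry (i+1, i+1) of the exchange relation determines r. *)
have rE : r = 1 + a * m.
  by have := E (hi i) (hi i); rewrite !eqxx hl v1 u1 -/m /=; lra.
have m0 : 0 <= m by exact: up.
have r0 : 0 < r by exact: lt_le_trans r1.
have vhi k : (k <= i)%N -> v k (hi i) = u k (hi i) / r.
  move=> ki; have := E k (hi i); rewrite hl eqxx -val_eqE /= ltn_eqF ?ltnS //.
  rewrite !mul0r mul1r !addr0 mulrBl mul1r addrC subrK => ->.
  by rewrite mulrAC divff ?mul1r // lt0r_neq0.
have vlo k : (k <= i)%N -> v k (lo i) <= u k (lo i) * r.
  move=> ki; have := E k (lo i); rewrite lh eqxx -val_eqE /= ltn_eqF ?ltnS //.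
  move=> H; rewrite -ler_pdivrMr //.
  have Q : 0 <= q * v k (hi i) by rewrite mulr_ge0.
  move: H; rewrite !mul0r mul1r !addr0 mulrBl mul1r => H.
  rewrite [_ / r]mulrC; lra.
have ex k l' : 0 <= a ^+ (l' - k) by rewrite exprn_ge0 // ltW.
have below k l' : (l' <= k)%N -> v k l' * a ^+ (l' - k) <= C.
  rewrite leq_eqVlt => /orP[/eqP/val_inj ->|lk]; last by rewrite v0 // mul0r ltW.
  by rewrite v1 subnn mulr1.
case=> [[/negPf llo /negPf lhi b]|[-> b]|[-> blo bhi]] k.
- have [/below ?|kl] := leqP l k; first exact: le_trans CC.
  have := E k l; rewrite llo lhi !mul0r !addr0 => <-.
  case: eqP => [kh|_]; last by rewrite mul0r addr0 (le_trans (b k)).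
  have H1 := b k; have := b (lo i).
  have -> : (l - lo i = (l - k).+1)%N.
    by move: kl; rewrite kh /= /bump /=; clear; lia.
  rewrite exprS mulrCA mulrA mul1r => H2.
  by apply: (@le_trans _ _ (C + C)); [rewrite mulrDl lerD|nra].
- have [/below ?|kl] := leqP (hi i) k; first exact: le_trans CC.
  have ki : (k <= i)%N by move: kl; rewrite /= /bump /=; clear; lia.
  rewrite vhi // (le_trans _ CC) // mulrAC ler_pdivrMr //.
  case: b => b; last first.
    by apply: le_trans (b k) _; rewrite ler_peMr // ltW.
  have hk : (hi i - k = (lo i - k).+1)%N.
    by move: ki; rewrite /= /bump /=; clear; lia.
  have := b k; have := um k i ki; rewrite hk exprS -/m => H1 H2.
  have Hx := ex k (lo i).
  apply: (@le_trans _ _ (u k (lo i) * m * (a * a ^+ (lo i - k)))).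
    by rewrite ler_wpM2r // mulr_ge0 // ltW.
  have am : 0 <= a * m by rewrite mulr_ge0 // ltW.
  rewrite rE; have : u k (lo i) * a ^+ (lo i - k) * (a * m) <= C * (a * m).
    by rewrite ler_wpM2r.
  by lra.
have [/below ?|kl] := leqP (lo i) k; first exact: le_trans CC.
have ki : (k <= i)%N by exact: ltnW.
apply: (@le_trans _ _ (r * (u k (lo i) * a ^+ (lo i - k)))).
  by rewrite mulrA ler_wpM2r // mulrC vlo.
have am : a * m <= C.
  have := bhi (lo i); rewrite -/m.
  have -> : (hi i - lo i = 1)%N by rewrite /= /bump /=; clear; lia.
  by rewrite expr1 mulrC.
by rewrite ler_pM // ?mulr_ge0 ?(ltW r0) // rE lerD2l.
Qed.

End Positive.

(** * The contracting word *)

Section Rounds.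
Context {K : fieldType} {n : nat}.
Implicit Types (i : 'I_n) (s : seq 'I_n) (a : K).

Definition lower_word s a : 'M[K]_n.+1 := \prod_(i <- s) lower i a.
Definition round : seq 'I_n := rev (enum 'I_n).
Definition contraction_word : seq 'I_n := flatten (nseq n round).

Lemma lower_word_cons i s a :
  lower_word (i :: s) a = lower i a *m lower_word s a.
Proof. by rewrite /lower_word big_cons. Qed.

Lemma lower_word_cat s1 s2 a :
  lower_word (s1 ++ s2) a = lower_word s1 a *m lower_word s2 a.
Proof. by rewrite /lower_word big_cat. Qed.

Lemma det_lower i a : \det (lower i a) = 1.
Proof.
rewrite det_trig.
  rewrite big1 // => k _; rewrite -[lower i a]mulmx1 lower_mul !mxE eqxx.
  case: eqVneq => [->|_]; rewrite ?mul0r ?addr0 //.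
  by rewrite -val_eqE /= ltn_eqF ?mulr0 ?addr0.
apply/is_trig_mxP => k l kl; rewrite -[lower i a]mulmx1 lower_mul !mxE.
rewrite -val_eqE ltn_eqF //= add0r; case: eqP => [kE|_]; rewrite ?mul0r //.
rewrite -val_eqE /= ltn_eqF ?mulr0 //.
by move: kl; rewrite kE /= /bump /=; lia.
Qed.

Lemma det_lower_word s a : \det (lower_word s a) = 1.
Proof.
elim: s => [|i s IH]; first by rewrite /lower_word big_nil det1.
by rewrite lower_word_cons det_mulmx det_lower IH mulr1.
Qed.

Lemma lower_inv i a : lower i a *m (1 - a *: chev_f i) = 1.
Proof.
rewrite mulmxBr mulmx1 /lower mulmxDl mul1mx -scalemxAl -scalemxAr chev_fE.
rewrite mul_delta_mx_cond -val_eqE /= /bump /= ltn_eqF //= mulr0n.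
by rewrite !scaler0 addr0 addrK.
Qed.

Lemma take_ord p (i : 'I_n) : i = p :> nat ->
  take p.+1 (enum 'I_n) = rcons (take p (enum 'I_n)) i.
Proof.
move=> ip; rewrite (take_nth i) ?size_enum_ord -?ip //.
by congr rcons; apply: val_inj; rewrite /= nth_enum_ord.
Qed.

(** Since f_i f_j = 0 for i < j, the product of the 1 - a f_i in increasing
order is 1 - a (f_1 + ... + f_p); and 1 - a f_i is the inverse of y_i(a). *)
Lemma prefix_inv p a : (p <= n)%N ->
  lower_word (rev (take p (enum 'I_n))) a *m
    (1 - a *: \sum_(i <- take p (enum 'I_n)) chev_f i) = 1.
Proof.
elim: p => [_|p IH pn].
  by rewrite take0 big_nil scaler0 subr0 /lower_word big_nil mulmx1.
set i := Ordinal pn; rewrite (take_ord (i := i)) // rev_rcons lower_word_cons.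
rewrite -cats1 big_cat /= big_seq1; set F := \sum_(i <- _) _.
have Fi : F *m chev_f i = 0.
  rewrite /F mulmx_suml big_seq big1 // => j.
  move=> /(map_f val); rewrite map_take val_enum_ord take_iota mem_iota => /andP[_ jp].
  rewrite !chev_fE mul_delta_mx_cond -val_eqE /= /bump /= ltn_eqF ?mulr0n //.
  by move: jp => /=; lia.
have -> : 1 - a *: (F + chev_f i) = (1 - a *: F) *m (1 - a *: chev_f i).
  rewrite mulmxBl mul1mx mulmxBr mulmx1 -scalemxAl -scalemxAr Fi !scaler0 subr0.
  by rewrite scalerDr opprD addrA addrAC.
rewrite -mulmxA (mulmxA (lower_word _ _)) IH ?mul1mx ?lower_inv //.
exact: ltnW.
Qed.

Lemma round_inv a : lower_word round a *m (1 - a *: prin_f) = 1.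
Proof.
have := @prefix_inv n a (leqnn n).
by rewrite take_oversize ?size_enum_ord // big_enum.
Qed.

(** P(a) is the inverse of 1 - a f, which commutes with f. *)
Lemma round_comm a : GRing.comm prin_f (lower_word round a).
Proof.
have V := round_inv a; have V' := mulmx1C V.
have c : GRing.comm prin_f (1 - a *: prin_f : 'M[K]_n.+1).
  apply: commrB; first exact: commr1.
  by rewrite /GRing.comm -scalerAl scalerAr.
rewrite /GRing.comm -[prin_f in LHS]mul1r -[1 in LHS]V -mulrA.
by rewrite mulrA -[_ * _ * prin_f]mulrA -c -!mulrA [(1 - _) * _]V' mulr1.
Qed.

Lemma contraction_comm a : GRing.comm prin_f (lower_word contraction_word a).
Proof.
rewrite /contraction_word; elim: (X in nseq X _) => [|m IH] /=.
  by rewrite /lower_word big_nil; exact: commr1.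
by rewrite lower_word_cat; apply: commrM => //; exact: round_comm.
Qed.

End Rounds.

Section Bound.
Context {R : realType} {n : nat} (w : seq 'I_n).
Implicit Types (u v b : 'M[R]_n.+1) (i : 'I_n) (s : seq 'I_n) (S : nat -> bool).

(** Multiplication by the word s makes the columns in S bounded, with one
constant for all parameters a and all totally positive matrices of the
word w. *)
Definition bounds_cols s S := exists2 C : R, 1 <= C &
  forall a u, 0 < a -> Uplus_pos w u -> exists v b,
    [/\ Uplus_pos w v, is_trig_mx b, lower_word s a *m u = v *m b &
        forall l : 'I_n.+1, S l -> col_bounded a C v l].

Lemma col_bounded0 (a : R) u (l : 'I_n.+1) :
  Uplus_pos w u -> l = 0%N :> nat -> col_bounded a 1 u l.
Proof.
move=> /Uplus_pos_entries[u0 u1 _ _] l0 k; rewrite l0 sub0n expr0 mulr1.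
have [->|kl] := eqVneq k l; first by rewrite u1.
rewrite u0 //; move: kl; rewrite -val_eqE /=; lia.
Qed.

Lemma bounds_cols_cons s S S' i : bounds_cols s S ->
  (forall l, S' l -> [\/ [/\ l != i, l != i.+1 & S l],
    l = i.+1 /\ (S i || S i.+1) | [/\ l = i, S i & S i.+1]]) ->
  bounds_cols (i :: s) S'.
Proof.
move=> [C C1 H] HS; exists ((1 + C) * C); first by nra.
move=> a u a0 /(H _ _ a0)[v [b [wv tb E bd]]].
have [z [r [q [wz r1 q0 E']]]] := lower_Uplus_pos i (ltW a0) wv.
exists z, (borel_factor i r q *m b); split=> //.
- by apply: trig_mulmx => //; exact: borel_factor_trig.
- by rewrite lower_word_cons -mulmxA E !mulmxA E'.
move=> l /HS Sl; apply: (col_bounded_lower a0 C1 r1 q0 wv wz E').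
case: Sl => [[li li' Sl]|[li Si]|[li Si Si']].
- by apply: Or31; split; rewrite -?val_eqE //; exact: bd.
- apply: Or32; split; first exact: val_inj.
  by case/orP: Si => Si; [left|right]; apply: bd.
- by apply: Or33; split; [exact: val_inj|exact: bd|exact: bd].
Qed.

Lemma bounds_cols_nil S : (forall l, S l -> (l == 0%N) || (n < l)%N) ->
  bounds_cols [::] S.
Proof.
move=> S0; exists 1 => // a u a0 wu; exists u, 1; split=> //.
- exact: scalar_mx_is_trig.
- by rewrite /lower_word big_nil mul1mx mulmx1.
move=> l /S0/orP[/eqP|nl]; first exact: col_bounded0.
by have := ltn_ord l; rewrite ltnS leqNgt nl.
Qed.

Lemma bounds_cols_sub s S S' : bounds_cols s S ->
  (forall l, S' l -> (l <= n)%N -> (l == 0%N) || S l) -> bounds_cols s S'.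
Proof.
move=> [C C1 H] SS; exists C => // a u a0 /(H _ _ a0)[v [b [wv tb E bd]]].
exists v, b; split=> // l /SS; rewrite -ltnS => /(_ (ltn_ord l)).
case/orP => [/eqP l0|]; last exact: bd.
exact: col_bounded_le (col_bounded0 a wv l0).
Qed.

(** Inside a round, the bound travels from the first column, where it is
trivial, one column to the right with each letter, until it reaches column
m - 1 and joins the columns that are already bounded; the later letters then
preserve all of these.  This is why min(p, m - 1) appears. *)
Lemma bounds_cols_prefix s m p : (0 < m)%N -> (p <= n)%N ->
  bounds_cols s (leq m) ->
  bounds_cols (rev (take p (enum 'I_n)) ++ s)
    (fun l => (m <= l) || (l == minn p m.-1))%N.
Proof.
move=> m0 + Hs; elim: p => [_|p IH pn].
  rewrite take0 /=; apply: bounds_cols_sub Hs _ => l; lia.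
rewrite (take_ord (i := Ordinal pn)) // rev_rcons /=.
apply: bounds_cols_cons (IH (ltnW pn)) _ => l /=.
have [->|lp] := eqVneq l p.
  by move=> H; apply: Or33; split=> //; lia.
have [->|lp'] := eqVneq l p.+1.
  by move=> H; apply: Or32; split=> //; lia.
move=> H; apply: Or31; split=> //; lia.
Qed.

(** After m rounds the last m columns are bounded, and the first column always
is. *)
Lemma contraction_bound : exists2 C : R, 1 <= C &
  forall a u, 0 < a -> Uplus_pos w u -> exists v b,
    [/\ Uplus_pos w v, is_trig_mx b,
        lower_word contraction_word a *m u = v *m b &
        forall k l : 'I_n.+1, v k l * a ^+ (l - k) <= C].
Proof.
suff H m : (m <= n)%N ->
    bounds_cols (flatten (nseq m round)) (leq (n.+1 - m)).
  have [C C1 {}H] : bounds_cols contraction_word predT.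
    by apply: bounds_cols_sub (H n (leqnn n)) _ => l; lia.
  exists C => // a u a0 /(H a u a0)[v [b [wv tb E bd]]].
  by exists v, b; split=> // k l; exact: bd.
elim: m => [_|m IH mn] /=; first by apply: bounds_cols_nil => l; lia.
have {}IH := IH (ltnW mn).
have m0 : (0 < n.+1 - m)%N by lia.
have := @bounds_cols_prefix _ _ n m0 (leqnn n) IH.
rewrite take_oversize ?size_enum_ord // => /bounds_cols_sub; apply=> l; lia.
Qed.

End Bound.

(** * The action on the flag variety *)

Section Group.
Context {K : fieldType} {n : nat}.
Implicit Types g h k : SL K n.

Lemma det_SL g : \det (\val g) = 1.
Proof. exact: set_mem (valP g). Qed.

Definition mkSL (A : 'M[K]_n.+1) (dA : \det A = 1) : SL K n :=
  Sub A (mem_set dA).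

Lemma SLmul_subproof g h : \det (\val g *m \val h) = 1.
Proof. by rewrite det_mulmx !det_SL mulr1. Qed.
Definition SLmul g h : SL K n := mkSL (SLmul_subproof g h).

Lemma SLinv_subproof g : \det (invmx (\val g)) = 1.
Proof. by rewrite det_inv det_SL invr1. Qed.
Definition SLinv g : SL K n := mkSL (SLinv_subproof g).

Definition SL1 : SL K n := mkSL (det1 K n.+1).

Lemma SLmulA : associative SLmul.
Proof. by move=> g h k; apply: val_inj; rewrite /= mulmxA. Qed.

Lemma SLmul1 g : SLmul SL1 g = g.
Proof. by apply: val_inj; rewrite /= mul1mx. Qed.

Lemma SLmulg1 g : SLmul g SL1 = g.
Proof. by apply: val_inj; rewrite /= mulmx1. Qed.

Lemma SLmulV g : SLmul g (SLinv g) = SL1.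
Proof. by apply: val_inj; rewrite /= mulmxV ?SL_unit. Qed.

Lemma SLmulVg g : SLmul (SLinv g) g = SL1.
Proof. by apply: val_inj; rewrite /= mulVmx ?SL_unit. Qed.

Lemma val_SLmul g h : \val (SLmul g h) = \val g *m \val h.
Proof. by []. Qed.

Definition flag_act g (x : flag K n) : flag K n :=
  \pi_(flag K n) (SLmul g (repr x)).

Lemma SLinvM k g : SLinv (SLmul k g) = SLmul (SLinv g) (SLinv k).
Proof.
have V : SLmul (SLmul k g) (SLmul (SLinv g) (SLinv k)) = SL1.
  by rewrite -SLmulA (SLmulA g) SLmulV SLmul1 SLmulV.
by rewrite -[LHS]SLmulg1 -V SLmulA SLmulVg SLmul1.
Qed.

Lemma same_cosetM g h k : same_coset (SLmul k g) (SLmul k h) = same_coset g h.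
Proof.
rewrite /same_coset; congr is_trig_mx.
rewrite -[invmx (\val (SLmul k g))]/(\val (SLinv (SLmul k g))) -val_SLmul.
rewrite -[invmx _]/(\val (SLinv g)) -val_SLmul; congr (\val _).
by rewrite SLinvM -!SLmulA (SLmulA _ k) SLmulVg SLmul1.
Qed.

Lemma flag_act_pi g h :
  flag_act g (\pi_(flag K n) h) = \pi_(flag K n) (SLmul g h).
Proof.
apply/eqmodP; rewrite /= same_cosetM.
by have /eqmodP := reprK (\pi_(flag K n) h).
Qed.

Lemma pi_trig g h (b : 'M[K]_n.+1) : is_trig_mx b ->
  \val g = \val h *m b -> \pi_(flag K n) g = \pi_(flag K n) h.
Proof.
move=> tb E; apply/esym/eqmodP => /=; rewrite /same_coset E mulKmx //.
exact: SL_unit.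
Qed.

End Group.

Section Peterson.
Context {R : realType} {n : nat}.

(** Membership in the Peterson variety is tested on some representative over
the complex numbers, and the condition on a representative does not change
when it is multiplied on the left by an element commuting with f. *)
Lemma flag_act_real_peterson (g : SL R n) (x : real_flag R n) :
  GRing.comm prin_f (\val g) -> real_peterson x ->
  real_peterson (flag_act g x : real_flag R n).
Proof.
move=> cg; have -> : x = \pi_(real_flag R n) (repr x) by rewrite reprK.
have -> : flag_act g (\pi_(real_flag R n) (repr x)) =
    \pi_(real_flag R n) (SLmul g (repr x)) by rewrite flag_act_pi.
rewrite /real_peterson /= !flag_complexify_pi.
have -> : SL_complexify (SLmul g (repr x)) =
    SLmul (SL_complexify g) (SL_complexify (repr x)).
  by apply: val_inj; rewrite /= map_mxM.
case=> h [xh hY]; exists (SLmul (SL_complexify g) h).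
split; first by rewrite -flag_act_pi xh flag_act_pi.
suff -> : invmx (\val (SLmul (SL_complexify g) h)) *m prin_f *m
    \val (SLmul (SL_complexify g) h) = invmx (\val h) *m prin_f *m \val h by [].
set G := SL_complexify g.
have cG : prin_f *m \val G = \val G *m prin_f :> 'M[R[i]]_n.+1.
  have -> : prin_f = map_mx (real_complex R) prin_f :> 'M[R[i]]_n.+1.
    rewrite /prin_f map_mx_sum; apply: eq_bigr => i _.
    by rewrite !chev_fE map_delta_mx.
  by rewrite -!map_mxM; congr map_mx; exact: cg.
have -> : invmx (\val (SLmul G h)) = invmx (\val h) *m invmx (\val G).
  by have := congr1 val (SLinvM G h).
rewrite val_SLmul -!mulmxA (mulmxA prin_f) cG -mulmxA (mulmxA (invmx (\val G))).
by rewrite mulVmx ?SL_unit // mul1mx.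
Qed.

Lemma real_peterson1 : real_peterson (\pi_(real_flag R n) SL1).
Proof.
rewrite /real_peterson /= flag_complexify_pi; exists (SL_complexify SL1); split=> //.
have -> : \val (SL_complexify (SL1 : SL R n)) = 1%:M :> 'M[R[i]]_n.+1.
  by rewrite /= map_mx1.
rewrite invmx1 mul1mx mulmx1; exists prin_f, (fun=> 0); split; last first.
  by rewrite big1 ?addr0 // => i _; rewrite scale0r.
split.
  apply/is_trig_mxP => i j ij; rewrite summxE big1 // => k _.
  rewrite chev_fE mxE -!val_eqE /=; case: eqP => //= ik; case: eqP => //= jk.
  by move: ij; rewrite ik jk /bump /=; lia.
rewrite raddf_sum big1 //= => i _; rewrite /mxtrace big1 // => k _.
rewrite chev_fE mxE -!val_eqE /=; case: eqP => //= ->; case: eqP => //=.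
by rewrite /bump /=; lia.
Qed.

End Peterson.

Section Topology.
Context {R : realType}.

Lemma cvg_mx (T : Type) m p (F : set_system T) {FF : Filter F}
  (f : T -> 'M[R]_(m, p)) (M : 'M[R]_(m, p)) :
  (forall i j, f x i j @[x --> F] --> M i j) -> f @ F --> M.
Proof.
move=> H A [P nP sPA]; rewrite nbhs_filterE /=.
have : \forall x \near F, forall i j, P i j (f x i j).
  apply: filter_forall => i; apply: filter_forall => j.
  exact: (H i j (P i j) (nP i j)).
by apply: filterS => x Px; exact: sPA.
Qed.

Lemma cvg_mxE (T : Type) m p (F : set_system T) {FF : Filter F}
  (f : T -> 'M[R]_(m, p)) (M : 'M[R]_(m, p)) i j :
  f @ F --> M -> f x i j @[x --> F] --> M i j.
Proof.
by move=> H A MA; exact: (H _ (coord_continuous MA)).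
Qed.

Lemma cvg_mulmx (T : Type) m p q (F : set_system T) {FF : Filter F}
  (f : T -> 'M[R]_(m, p)) (g : T -> 'M[R]_(p, q))
  (A : 'M[R]_(m, p)) (B : 'M[R]_(p, q)) :
  f @ F --> A -> g @ F --> B -> f x *m g x @[x --> F] --> A *m B.
Proof.
move=> fA gB; apply: cvg_mx => i j; rewrite mxE.
under eq_fun do rewrite mxE.
apply: cvg_big => [|k _]; first exact: add_continuous.
by apply: cvgM; exact: cvg_mxE.
Qed.

Lemma cvg_det (T : Type) m (F : set_system T) {FF : Filter F}
  (f : T -> 'M[R]_m) (M : 'M[R]_m) :
  f @ F --> M -> \det (f x) @[x --> F] --> \det M.
Proof.
move=> fM; apply: cvg_big => [|s _]; first exact: add_continuous.
apply: cvgM; first exact: cvg_cst.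
apply: cvg_big => [|i _]; [exact: mul_continuous|exact: cvg_mxE].
Qed.

Lemma cvg_adj (T : Type) m (F : set_system T) {FF : Filter F}
  (f : T -> 'M[R]_m) (M : 'M[R]_m) :
  f @ F --> M -> \adj (f x) @[x --> F] --> \adj M.
Proof.
move=> fM; apply: cvg_mx => i j; rewrite mxE; under eq_fun do rewrite mxE.
apply: cvgM; first exact: cvg_cst.
apply: cvg_det; apply: cvg_mx => k l; rewrite !mxE.
by under eq_fun do rewrite !mxE; exact: cvg_mxE.
Qed.

Lemma cvg_lower_word (T : Type) n (F : set_system T) {FF : Filter F}
  (s : seq 'I_n) (f : T -> R) (a : R) :
  f @ F --> a -> lower_word s (f x) @[x --> F] --> lower_word s a.
Proof.
move=> fa; elim: s => [|i s IH].
  by rewrite /lower_word big_nil; under eq_fun do rewrite big_nil; exact: cvg_cst.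
rewrite lower_word_cons; under eq_fun do rewrite lower_word_cons.
apply: cvg_mulmx => //; apply: cvg_mx => k l; rewrite mxE (mxE scalemx_key).
under eq_fun do rewrite mxE (mxE scalemx_key).
by apply: cvgD; [exact: cvg_cst|apply: cvgM => //; exact: cvg_cst].
Qed.

Context {n : nat}.
Implicit Types (g h k : SL R n) (x y : real_flag R n).

Lemma cvg_SL (T : Type) (F : set_system T) {FF : Filter F}
  (f : T -> SL R n) g :
  \val (f x) @[x --> F] --> \val g -> f @ F --> g.
Proof.
move=> H A [B [[C oC <-] Cg] sBA]; rewrite nbhs_filterE /=.
have HC : F [set x | C (\val (f x))] by apply: H; exact: open_nbhs_nbhs.
by apply: filterS HC => x; exact: sBA.
Qed.

Lemma cvg_SL_val (T : Type) (F : set_system T) {FF : Filter F}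
  (f : T -> SL R n) g :
  f @ F --> g -> \val (f x) @[x --> F] --> \val g.
Proof. by move=> H A gA; exact: (H _ (initial_continuous gA)). Qed.

Lemma cvg_SLmul (T : Type) (F : set_system T) {FF : Filter F}
  (f f' : T -> SL R n) g g' :
  f @ F --> g -> f' @ F --> g' -> SLmul (f x) (f' x) @[x --> F] --> SLmul g g'.
Proof.
by move=> fg fg'; apply: cvg_SL; apply: cvg_mulmx; exact: cvg_SL_val.
Qed.

Lemma cvg_SLinv (T : Type) (F : set_system T) {FF : Filter F}
  (f : T -> SL R n) g : f @ F --> g -> SLinv (f x) @[x --> F] --> SLinv g.
Proof.
have E k : \val (SLinv k) = \adj (\val k).
  by rewrite /= /invmx SL_unit det_SL invr1 scale1r.
move=> fg; apply: cvg_SL; rewrite E; under eq_fun do rewrite E.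
by apply: cvg_adj; exact: cvg_SL_val.
Qed.

Lemma SLmulr_continuous d : continuous (fun k : SL R n => SLmul k d).
Proof.
move=> k; apply: (@cvg_SLmul _ (nbhs (k : SL R n))).
  by move=> A.
move=> A dA.
by apply: (@nearW _ (nbhs (k : SL R n))) => ? /=; exact: nbhs_singleton.
Qed.

(** The projection to the flag variety is open: the saturation of an open set
is the union of its right translates by B^-. *)
Lemma pi_nbhs g (B : set (SL R n)) :
  nbhs g B -> nbhs (\pi_(real_flag R n) g) (\pi_(real_flag R n) @` B).
Proof.
rewrite nbhsE => -[C [oC Cg] CB].
apply: (@filterS _ _ _ (\pi_(real_flag R n) @` C)); first exact: image_subset.
apply: open_nbhs_nbhs; split; last by exists g.
rewrite /open /= /quotient_open openE => k /= [c Cc kc].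
pose d := SLmul (SLinv k) c.
have : nbhs (SLmul k d) C.
  by rewrite /d SLmulA SLmulV SLmul1; exact: open_nbhs_nbhs.
move=> /(@SLmulr_continuous d k) Z.
apply: (@filterS _ (nbhs (k : SL R n)) _ _ _ _ Z) => k' Ck'.
exists (SLmul k' d) => //.
apply: (@pi_trig _ _ _ _ (\val d)) => //.
by have /esym/eqmodP := kc.
Qed.

(** The quotient topology alone does not make the product of the identity with
the projection a quotient map; openness of the projection replaces this. *)
Lemma flag_act_continuous :
  continuous
    (fun p : SL R n * real_flag R n => flag_act p.1 p.2 : real_flag R n).
Proof.
move=> [g x] V; rewrite -[x]reprK /=; set k := repr x.
rewrite nbhs_filterE /=.
have -> : flag_act g (\pi_(real_flag R n) k) = \pi_(real_flag R n) (SLmul g k).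
  exact: flag_act_pi.
have H : \pi_(real_flag R n) (SLmul p.1 p.2) @[p --> (g, k)] -->
    \pi_(real_flag R n) (SLmul g k).
  apply: (@cvg_comp _ _ _ (fun p => SLmul p.1 p.2) \pi_(real_flag R n)); last first.
    exact: pi_continuous.
  by apply: cvg_SLmul; [exact: cvg_fst|exact: cvg_snd].
move=> /H [[A B] /= [gA kB] AB]; exists (A, \pi_(real_flag R n) @` B) => /=.
  by split=> //; exact: pi_nbhs.
move=> [h _] /= [Ah [b Bb <-]].
have -> : flag_act h (\pi_(real_flag R n) b) = \pi_(real_flag R n) (SLmul h b).
  exact: flag_act_pi.
exact: (AB (h, b)).
Qed.

Lemma SL_nbhs_entries g (B : set (SL R n)) : nbhs g B ->
  exists2 e : R, 0 < e & forall h,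
    (forall i j, `|\val g i j - \val h i j| < e) -> B h.
Proof.
move=> [D [[C oC <-] Cg] sDB].
have /nbhs_ballP [e e0 eC] : nbhs (\val g) C by exact: open_nbhs_nbhs.
exists e => // h H; apply: sDB; apply: eC; split=> //.
Qed.

End Topology.

(** * The contraction *)

Section Flow.
Context {R : realType} {n : nat} (w : seq 'I_n).
Implicit Types (g h k : SL R n) (x y : real_flag R n) (a t : R).

Definition base_flag : real_flag R n := \pi_(real_flag R n) SL1.

Definition flow a : SL R n := mkSL (det_lower_word contraction_word a).

Lemma Uplus_pos_det (u : 'M[R]_n.+1) : Uplus_pos w u -> \det u = 1.
Proof.
move=> /Uplus_pos_entries[u0 u1 _ _]; rewrite -det_tr det_trig.
  by rewrite big1 // => k _; rewrite mxE.
by apply/is_trig_mxP => k l kl; rewrite mxE u0.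
Qed.

Lemma lower_word_Uplus_pos s a (u : 'M[R]_n.+1) : 0 <= a -> Uplus_pos w u ->
  exists v b, [/\ Uplus_pos w v, is_trig_mx b & lower_word s a *m u = v *m b].
Proof.
move=> a0 wu; elim: s => [|i s [v [b [wv tb E]]]].
  exists u, 1; split=> //; first exact: scalar_mx_is_trig.
  by rewrite /lower_word big_nil mul1mx mulmx1.
have [z [r [q [wz _ _ E']]]] := lower_Uplus_pos i a0 wv.
exists z, (borel_factor i r q *m b); split=> //.
  by apply: trig_mulmx => //; exact: borel_factor_trig.
by rewrite lower_word_cons -mulmxA E !mulmxA E'.
Qed.

Lemma flow_flag_pos a x :
  0 <= a -> flag_pos w x -> flag_pos w (flag_act (flow a) x).
Proof.
move=> a0 [u wu ->].
have [v [b [wv tb E]]] := lower_word_Uplus_pos contraction_word a0 wu.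
exists (mkSL (Uplus_pos_det wv)) => //.
transitivity (\pi_(real_flag R n) (SLmul (flow a) u)); first exact: flag_act_pi.
exact: (pi_trig tb).
Qed.

Lemma flag_act_cvg (T : Type) (F : set_system T) {FF : Filter F}
  (f : T -> SL R n) (f' : T -> real_flag R n) g x :
  f @ F --> g -> f' @ F --> x ->
  (flag_act (f z) (f' z) : real_flag R n) @[z --> F] -->
    (flag_act g x : real_flag R n).
Proof.
move=> fg fx V /(@flag_act_continuous R n (g, x)).
exact: (cvg_pair fg fx).
Qed.

Lemma flow_flag_nneg a x :
  0 <= a -> flag_nneg w x -> flag_nneg w (flag_act (flow a) x).
Proof.
move=> a0 cx V nV.
have : nbhs x [set y | V (flag_act (flow a) y)].
  by apply: (@flag_act_cvg _ (nbhs x) _ (fun=> flow a) id);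
    [exact: cvg_cst|exact: cvg_id|].
move=> /cx[y [py Vy]]; exists (flag_act (flow a) y); split=> //.
exact: flow_flag_pos.
Qed.

Lemma flow_cvg (T : Type) (F : set_system T) {FF : Filter F} (f : T -> R) a :
  f @ F --> a -> flow (f x) @[x --> F] --> flow a.
Proof. by move=> fa; apply: cvg_SL; exact: cvg_lower_word. Qed.

Lemma flow0 : flow 0 = SL1.
Proof.
apply: val_inj => /=; rewrite /lower_word big1 // => i _.
by rewrite /lower scale0r addr0.
Qed.

Lemma flag_act_SL1 x : flag_act SL1 x = x.
Proof.
rewrite -[in LHS](reprK x); transitivity (\pi_(real_flag R n) (SLmul SL1 (repr x))).
  exact: flag_act_pi.
by rewrite SLmul1 reprK.
Qed.

(** Near the base point, g k B^- lies in V for g and k close to 1.  On the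
totally positive part h(a) sends x_w(t) to k B^- with k close to 1 by
[contraction_bound].  A point x of the closure is represented by some k0 with
h(a) k0 = m h(a) g, where g represents a totally positive flag and m is as
close to 1 as desired, since the g with m close to 1 project to a neighbourhood
of x.  Hence h(a) x = m k B^- lies in V, with a threshold on a that does not
depend on x. *)
Lemma flow_contraction (V : set (real_flag R n)) : nbhs base_flag V ->
  exists2 A : R, 1 <= A &
    forall a x, A <= a -> flag_nneg w x -> V (flag_act (flow a) x).
Proof.
move=> nV.
have [[M B] [/= nM nB] MB] : nbhs ((SL1, SL1) : SL R n * SL R n)
    [set p | V (\pi_(real_flag R n) (SLmul p.1 p.2))].
  have : nbhs (\pi_(real_flag R n) (SLmul (SL1 : SL R n) SL1)) V by rewrite SLmul1.
  have H : SLmul p.1 p.2 @[p --> ((SL1, SL1) : SL R n * SL R n)] -->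
      (SLmul SL1 SL1 : SL R n).
    by apply: cvg_SLmul; [exact: cvg_fst|exact: cvg_snd].
  by move=> /(@pi_continuous _ (flag R n)) /H.
have [e e0 eB] := SL_nbhs_entries nB.
have [C C1 bnd] := @contraction_bound R n w.
exists (1 + C / e).
  by rewrite lerDl divr_ge0 // ltW // (lt_le_trans ltr01).
move=> a x Aa cx.
have a1 : 1 <= a.
  by rewrite (le_trans _ Aa) // lerDl divr_ge0 // ltW // (lt_le_trans ltr01).
have a0 : 0 < a by exact: lt_le_trans a1.
have Ca : C / a < e.
  rewrite ltr_pdivrMr // mulrC -ltr_pdivrMr //; lra.
have close (v : 'M[R]_n.+1) (wv : Uplus_pos w v) :
    (forall k l : 'I_n.+1, v k l * a ^+ (l - k) <= C) ->
    B (mkSL (Uplus_pos_det wv)).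
  have [v0 v1 vp _] := Uplus_pos_entries wv.
  move=> vC; apply: eB => k l; rewrite mxE /=.
  have [->|] := eqVneq k l; first by rewrite v1 subrr normr0.
  rewrite -val_eqE neq_ltn /= => /orP[kl|lk]; last by rewrite v0 // subr0 normr0.
  rewrite sub0r normrN ger0_norm // (le_lt_trans _ Ca) // ler_pdivlMr //.
  apply: le_trans (vC k l); rewrite ler_wpM2l //.
  have -> : (l - k = (l - k).-1.+1)%N by lia.
  by rewrite exprS ler_peMr ?exprn_ege1 // ltW.
pose k0 := repr x; pose h := flow a.
pose m g := SLmul (SLmul h (SLmul k0 (SLinv g))) (SLinv h).
have mh g : SLmul (m g) (SLmul h g) = SLmul h k0.
  rewrite /m -!SLmulA (SLmulA (SLinv h)) SLmulVg SLmul1.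
  by rewrite SLmulVg SLmulg1.
have mM : nbhs k0 [set g | M (m g)].
  have H : m g @[g --> (k0 : SL R n)] --> m k0.
    apply: (@cvg_SLmul _ _ _ (nbhs (k0 : SL R n))); last exact: cvg_cst.
    apply: (@cvg_SLmul _ _ _ (nbhs (k0 : SL R n))); first exact: cvg_cst.
    apply: (@cvg_SLmul _ _ _ (nbhs (k0 : SL R n))); first exact: cvg_cst.
    apply: (@cvg_SLinv _ _ _ (nbhs (k0 : SL R n))).
    exact: cvg_id.
  apply: H; suff -> : m k0 = SL1 by [].
  by rewrite /m SLmulV SLmulg1 SLmulV.
have := pi_nbhs mM; have -> : \pi_(real_flag R n) k0 = x by rewrite /k0 reprK.
move=> /cx [_ [[u wu ->] [g Mg gu]]].
have [v [b [wv tb E vC]]] := bnd a _ a0 wu.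
have -> : flag_act h x = \pi_(real_flag R n) (SLmul (m g) (mkSL (Uplus_pos_det wv))).
  transitivity (flag_act (m g) (flag_act h (\pi_(flag R n) g))).
    rewrite !flag_act_pi mh -flag_act_pi; congr flag_act.
    by rewrite /k0; exact/esym/reprK.
  have -> : \pi_(flag R n) g = \pi_(flag R n) u by exact: gu.
  rewrite flag_act_pi (pi_trig (h := mkSL (Uplus_pos_det wv)) tb) ?flag_act_pi //.
exact: (MB (m g, _) (conj Mg (close v wv vC))).
Qed.

(** The contraction itself produces totally positive flags arbitrarily close to
B^-. *)
Lemma base_nneg : flag_nneg w base_flag.
Proof.
move=> V /flow_contraction[A A1 H].
have [u wu] := @Uplus_pos_nonempty R n w.
pose x := \pi_(real_flag R n) (mkSL (Uplus_pos_det wu)).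
have px : flag_pos w x by exists (mkSL (Uplus_pos_det wu)).
exists (flag_act (flow A) x); split.
  by apply: flow_flag_pos => //; exact: le_trans A1.
by apply: H => //; exact: subset_closure.
Qed.

Lemma flow_peterson_nneg a x :
  0 <= a -> peterson_nneg w x -> peterson_nneg w (flag_act (flow a) x).
Proof.
move=> a0 [Yx px]; split; last exact: flow_flag_nneg.
by apply: flag_act_real_peterson => //; exact: contraction_comm.
Qed.

Lemma base_peterson_nneg : peterson_nneg w base_flag.
Proof. by split; [exact: real_peterson1|exact: base_nneg]. Qed.

(** The absolute value keeps the time nonnegative for every t < 1, so that the
flow preserves the nonnegative part also for t < 0 and the map below is
continuous on the whole line. *)
Definition flow_time t : R := `|t| / (1 - t).
Definition contraction (p : real_flag R n * R) : real_flag R n :=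
  if p.2 < 1 then flag_act (flow (flow_time p.2)) p.1 else base_flag.

Lemma contraction_peterson p :
  peterson_nneg w p.1 -> peterson_nneg w (contraction p).
Proof.
rewrite /contraction => Yx; case: ifPn => [t1|_]; last exact: base_peterson_nneg.
by apply: flow_peterson_nneg => //; rewrite divr_ge0 // subr_ge0 ltW.
Qed.

(* The threshold for t makes t >= 1/2 and 1 - t <= 1 / (2A). *)
Lemma flow_time_ge (A t : R) :
  1 <= A -> 1 - (A *+ 2)^-1 < t -> t < 1 -> A <= flow_time t.
Proof.
move=> A1 tA t1; have A0 : 0 < A *+ 2 by rewrite mulr2n; lra.
have iA : (A *+ 2)^-1 * (A *+ 2) = 1 by rewrite mulVf // lt0r_neq0.
rewrite /flow_time ler_pdivlMr ?subr_gt0 // (le_trans _ (ler_norm t)) //.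
have : (1 - t) * (A *+ 2) <= 1.
  by rewrite -iA ler_wpM2r ?ltW //; lra.
have : (A *+ 2)^-1 <= 2^-1.
  by rewrite lef_pV2 ?posrE // mulr2n; lra.
move: tA; rewrite mulr2n; lra.
Qed.

(** Only for t >= 1 does continuity use that the flags f z are totally
nonnegative: without it the convergence to the base point is not uniform. *)
Lemma contraction_cvg (T : Type) (F : set_system T) {FF : Filter F}
  (f : T -> real_flag R n) (s : T -> R) x t :
  f @ F --> x -> s @ F --> t -> (forall z, flag_nneg w (f z)) ->
  contraction (f z, s z) @[z --> F] --> contraction (x, t).
Proof.
move=> fx st fw; rewrite /contraction /=; case: ifPn => [t1|].
  have H : flag_act (flow (flow_time (s z))) (f z) @[z --> F] -->
      (flag_act (flow (flow_time t)) x : real_flag R n).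
    apply: flag_act_cvg => //; apply: flow_cvg; apply: cvgM.
      exact: cvg_norm.
    apply: cvgV; first by rewrite subr_eq0 gt_eqF.
    by apply: cvgB => //; exact: cvg_cst.
  move=> V /H FV; have Fs : \forall z \near F, s z < 1.
    exact: (st _ (lt_nbhsl t1)).
  rewrite nbhs_filterE /=; near=> z.
  rewrite /= (_ : s z < 1); last by near: z.
  by near: z.
rewrite -leNgt => t1 V nV; have [A A1 HA] := flow_contraction nV.
have Fs : \forall z \near F, 1 - (A *+ 2)^-1 < s z.
  apply: (st _ (lt_nbhsr _)).
  rewrite (lt_le_trans _ t1) // ltrBlDr ltrDl invr_gt0 mulrn_wgt0 //.
  exact: lt_le_trans A1.
apply: filterS Fs => z sz /=; case: ifPn => [s1|_]; last exact: nbhs_singleton.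
by apply: HA => //; exact: flow_time_ge.
Unshelve. all: by end_near. Qed.

End Flow.

Theorem corollary10p5 (R : realType) (n : nat) (w0 : 'S_n.+1) (w : seq 'I_n)
  (hw0 : longest_element w0) (hw : reduced_expression w0 w) :
  contractible R (set_type (@peterson_nneg R n w)).
Proof.
pose Y := set_type (@peterson_nneg R n w).
have HY (p : Y * R) : contraction (\val p.1, p.2) \in @peterson_nneg R n w.
  by apply/mem_set/contraction_peterson/set_mem/valP.
pose H (p : Y * R) : Y := Sub (contraction (\val p.1, p.2)) (HY p).
exists (Sub base_flag (mem_set (base_peterson_nneg w)) : Y), H; split.
- apply: continuous_subspaceT; apply: continuous_comp_initial => -[y t].
  apply: (@contraction_cvg R n w _ (nbhs (y, t)) _ (fun p => \val p.1) snd (\val y) t).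
  + move=> V /initial_continuous; rewrite nbhs_filterE => nV.
    exact: (@cvg_fst _ _ (nbhs y) (nbhs t) _ (\val @^-1` V) nV).
  + exact: cvg_snd.
  + by move=> [z r]; have [] := set_mem (valP z).
- move=> y; apply: val_inj; rewrite /= /contraction /= ltr01 /flow_time normr0 mul0r.
  by rewrite flow0 flag_act_SL1.
- by move=> y; apply: val_inj; rewrite /= /contraction /= ltxx.
Qed.
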